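(* Let $k\in\mathbb{N}$, let $\alpha_0,\dots,\alpha_k>0$, $\boldsymbol{\alpha}=[\alpha_0,\dots,\alpha_k]^\top$, and let $\boldsymbol{X}=[X_0,\dots,X_k]^\top$ have the Dirichlet distribution with density $\frac1{\mathcal{B}(\boldsymbol{\alpha})}\prod_{i=0}^kx_i^{\alpha_i-1}$ on $\{x_i>0,\ \sum_{i=0}^kx_i=1\}$, where $\mathcal{B}(\boldsymbol{\alpha})=\prod_{i=0}^k\Gamma(\alpha_i)/\Gamma(\sum_{i=0}^k\alpha_i)$. Let $\mu_i=\alpha_i/\sum_{\ell=0}^k\alpha_\ell$, $\boldsymbol{\mu}=[\mu_0,\dots,\mu_k]^\top$. Let $\boldsymbol{\mathcal{X}}_1,\dots,\boldsymbol{\mathcal{X}}_n$ be independent random vectors with the same distribution as $\boldsymbol{X}$ and $\overline{\boldsymbol{\mathcal{X}}}_n=\frac1n\sum_{\ell=1}^n\boldsymbol{\mathcal{X}}_\ell$. Let $z_0,\dots,z_k$ be positive reals with $\sum_{\ell=0}^kz_\ell=1$, $\boldsymbol{z}=[z_0,\dots,z_k]^\top$, and $\widehat{\boldsymbol{\alpha}}=[\widehat\alpha_0,\dots,\widehat\alpha_k]^\top$ with $\widehat\alpha_i=\alpha_0z_i/z_0$. If $\boldsymbol{z}\boldsymbol{\prec}\boldsymbol{\mu}$, then $$\Pr\{\overline{\boldsymbol{\mathcal{X}}}_n\boldsymbol{\prec}\boldsymbol{z}\}\le\Big[\frac{\mathcal{B}(\widehat{\boldsymbol{\alpha}})}{\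mathcal{B}(\boldsymbol{\alpha})}\prod_{i=1}^k\frac{z_i^{\alpha_i}}{z_i^{\widehat\alpha_i}}\Big]^n.$$
   Context: For vectors $\boldsymbol{x}=[x_0,\dots,x_k]^\top,\boldsymbol{y}=[y_0,\dots,y_k]^\top$, $\boldsymbol{x}\boldsymbol{\prec}\boldsymbol{y}$ means $x_i\le y_i$ for $i=1,\dots,k$ (index $0$ is not compared). *)

(* Defs.v *)
From HB Require Import structures.
From mathcomp Require Import all_boot all_order all_algebra.
From mathcomp Require Import all_classical all_reals all_analysis.

Set Implicit Arguments.
Unset Strict Implicit.
Unset Printing Implicit Defensive.

Import Order.TTheory GRing.Theory Num.Theory.
Import numFieldNormedType.Exports.

Local Open Scope classical_set_scope.
Local Open Scope ring_scope.

Section Dirichlet.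
Context {R : realType}.

Local Notation leb := (@lebesgue_measure R).

Definition Gamma (s : R) : R :=
  fine (\int[leb]_(t in `]0%R, +oo[) ((t `^ (s - 1)) * expR (- t))%:E)%E.

Definition mBeta (k : nat) (a : 'I_k.+1 -> R) : R :=
  (\prod_(i < k.+1) Gamma (a i)) / Gamma (\sum_(i < k.+1) a i).

(* Integral w.r.t. Lebesgue measure on R^m of a nonnegative function,
   written as the iterated Lebesgue integral over the m coordinates. *)
Fixpoint lebInt (m : nat) : (m.-tuple R -> \bar R) -> \bar R :=
  match m return (m.-tuple R -> \bar R) -> \bar R with
  | 0 => fun f => f [tuple]
  | m'.+1 => fun f =>
      (\int[leb]_x lebInt (fun t : m'.-tuple R => f (cons_tuple x t)))%E
  end.

(* The point (1 - x_1 - ... - x_k, x_1, ..., x_k) of the hyperplane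
   sum x_i = 1 parametrized by its last k coordinates. *)
Definition simplex_pt (k : nat) (y : k.-tuple R) : k.+1.-tuple R :=
  cons_tuple (1 - \sum_(i < k) tnth y i) y.

(* Dirichlet(a) density on {x_i > 0, sum_i x_i = 1}, w.r.t. Lebesgue measure
   in the coordinates x_1, ..., x_k. *)
Definition dirichlet_density (k : nat) (a : 'I_k.+1 -> R)
    (x : k.+1.-tuple R) : R :=
  if [forall i, 0 < tnth x i]
  then (\prod_(i < k.+1) (tnth x i) `^ (a i - 1)) / mBeta a
  else 0.

Definition has_dirichlet_law d (Omega : measurableType d)
    (P : probability Omega R) (k : nat) (a : 'I_k.+1 -> R)
    (Y : Omega -> k.+1.-tuple R) : Prop :=
  forall A : set (k.+1.-tuple R), measurable A ->
    P (Y @^-1` A) =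
    lebInt (fun y : k.-tuple R =>
      ((\1_A (simplex_pt y) : R) * dirichlet_density a (simplex_pt y))%:E).

Definition mutually_independent d (Omega : measurableType d)
    (P : probability Omega R) (n k : nat)
    (Y : 'I_n -> Omega -> k.+1.-tuple R) : Prop :=
  forall A : 'I_n -> set (k.+1.-tuple R), (forall l, measurable (A l)) ->
    P (\bigcap_(l in [set: 'I_n]) (Y l @^-1` A l)) =
    (\prod_(l < n) P (Y l @^-1` A l))%E.

Definition prec (k : nat) (x y : 'I_k.+1 -> R) : Prop :=
  forall i : 'I_k.+1, (0 < i)%N -> x i <= y i.

End Dirichlet.

(* Main.v *)
(* Chernoff-type likelihood-ratio argument.  Since z_i <= mu_i for i >= 1, every
   theta_i = alpha_i - alphahat_i (i >= 1) is nonnegative, so by AM-GM the product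
   over l of h(X_l), where h(x) = prod_(i >= 1) (z_i / x_i)^theta_i, is at least 1
   whenever the sample mean is coordinatewise below z.  By independence the
   probability is at most E[h(X)]^n.  As alphahat_0 = alpha_0, the product of h and
   the Dirichlet(alpha) density is a multiple of the Dirichlet(alphahat) density,
   and Dirichlet's integral, obtained by iterating Euler's beta integral, gives
   the value of E[h(X)]. *)

Require Import Defs.
From HB Require Import structures.
From mathcomp Require Import all_boot all_order all_algebra.
From mathcomp Require Import ring lra.
From mathcomp Require Import all_classical all_reals all_analysis.
From mathcomp Require Import measurable_realfun.

Import Order.TTheory GRing.Theory Num.Theory.
Import numFieldNormedType.Exports.

Local Open Scope classical_set_scope.
Local Open Scope ring_scope.

Set Implicit Arguments.
Unset Strict Implicit.
Unset Printing Implicit Defensive.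

(** * Affine change of variables on the real line *)

Section affine.
Context {R : realType}.
Local Notation leb := (@lebesgue_measure R).
Local Open Scope ereal_scope.

Let affine_map (r c : R) (x : measurableTypeR R) : measurableTypeR R :=
  (r * x + c)%R.

Let measurable_affine (r c : R) : measurable_fun setT (affine_map r c).
Proof. by apply: measurable_funD => //; exact: measurable_funM. Qed.

(** The image of Lebesgue measure under [x |-> r * x + c], scaled by [r], gives every half-open
    interval its length, so it is Lebesgue measure by uniqueness. *)
Lemma ge0_integral_affine (r c : R) (f : R -> \bar R) : (0 < r)%R ->
  measurable_fun setT f -> (forall x, 0 <= f x) ->
  \int[leb]_x f x = r%:E * \int[leb]_x f (r * x + c)%R.
Proof.
move=> r0 mf f0.
have := ge0_integral_pushforward (measurable_affine r c) leb measurableT mf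
  (fun x _ => f0 x).
rewrite preimage_setT => <-.
rewrite -[r]/((NngNum (ltW r0))%:num) -ge0_integral_mscale//.
apply: eq_measure_integral => A mA _; apply: lebesgue_measure_unique => //.
move=> _ [[a b] _ <-]/=.
rewrite /mscale/= /pushforward.
have -> : affine_map r c @^-1` `]a, b] = `]((a - c) / r)%R, ((b - c) / r)%R]%classic.
  apply/seteqP; split => x; rewrite /= !in_itv/= /affine_map;
    by rewrite ltr_pdivrMr// ler_pdivlMr// ltrBlDr lerBrDr (mulrC r x).
rewrite !lebesgue_measure_itv/= !lte_fin ltr_pM2r ?invr_gt0// ltrD2r.
case: ifPn => _; last by rewrite mule0.
by rewrite -EFinD -EFinM; congr (_%:E); field; rewrite gt_eqF.
Qed.
End affine.

(** * Euler's gamma and beta integrals *)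

Section euler_integrals.
Context {R : realType}.
Local Notation leb := (@lebesgue_measure R).

(** The cutoff puts the domain of integration into the integrand, so that all integrals run over the
    whole line; [powR] itself does not vanish at negative arguments. *)
Definition pospow (s x : R) : R := if 0 < x then x `^ (s - 1) else 0.

Lemma pospow_ge0 (s x : R) : 0 <= pospow s x.
Proof. by rewrite /pospow; case: ifP => // _; exact: powR_ge0. Qed.

Lemma measurable_pospow (s : R) : measurable_fun setT (pospow s).
Proof.
by apply: measurable_fun_ifT => //; exact: measurable_fun_ltr.
Qed.

Lemma pospow_scale (s u x : R) : 0 < u ->
  pospow s (u * x) = u `^ (s - 1) * pospow s x.
Proof.
move=> u0; rewrite /pospow pmulr_rgt0//; case: ifPn => x0; last by rewrite mulr0.
by rewrite powRM// ltW.
Qed.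

(** Keeping the value in [\bar R] lets Tonelli's theorem be used without finiteness; [Gamma] passes
    through [fine], which would hide an infinite integral. *)
Definition egamma (s : R) : \bar R :=
  (\int[leb]_t (pospow s t * expR (- t))%:E)%E.

Lemma egammaE (s : R) :
  egamma s = (\int[leb]_(t in `]0%R, +oo[) ((t `^ (s - 1)) * expR (- t))%:E)%E.
Proof.
rewrite [RHS]integral_mkcond; apply: eq_integral => t _.
rewrite patchE /pospow; case: ifPn; first by move=> t0; rewrite mem_set//= in_itv/= t0.
by move=> t0; rewrite mul0r memNset//= in_itv/= andbT; exact/negP.
Qed.

Lemma measurable_gamma_density (s : R) :
  measurable_fun setT (fun t : R => pospow s t * expR (- t)).
Proof.
apply: measurable_funM; first exact: measurable_pospow.
exact: measurableT_comp.
Qed.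

Lemma gamma_density_ge0 (s t : R) : 0 <= pospow s t * expR (- t).
Proof. by rewrite mulr_ge0 ?pospow_ge0 ?expR_ge0. Qed.

(** On [[1, 2]] the integrand is at least [2^-1 * expR (- 2)], because [s - 1 >= -1] and [t >= 1]
    give [t ^ (s - 1) >= t^-1 >= 2^-1]. *)
Lemma egamma_gt0 (s : R) : 0 < s -> (0 < egamma s)%E.
Proof.
move=> s0.
apply: (@lt_le_trans _ _ (\int[leb]_(t in `[1%R, 2%R]) (2^-1 * expR (- 2))%:E)%E).
  rewrite integral_cst//= lebesgue_measure_itv/= lte_fin ltr1n -EFinD -EFinM lte_fin.
  by rewrite !mulr_gt0 ?expR_gt0// subr_gt0 ltr1n.
apply: (@le_trans _ _ (\int[leb]_(t in `[1%R, 2%R]) (pospow s t * expR (- t))%:E)%E); last first.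
  apply: ge0_subset_integral => //.
  - apply/measurable_EFinP; exact: measurable_gamma_density.
  - by move=> t _; rewrite lee_fin gamma_density_ge0.
apply: ge0_le_integral => //.
- by apply/measurable_EFinP/measurable_funTS; exact: measurable_gamma_density.
move=> t /=; rewrite in_itv/= => /andP[t1 t2].
have t0 : 0 < t by rewrite (lt_le_trans _ t1).
rewrite lee_fin ler_pM ?expR_ge0 ?ler_expR ?lerN2// /pospow t0.
apply: (@le_trans _ _ (t `^ (-1))); last by rewrite ler_powR// lerBrDr addNr ltW.
by rewrite powR_inv1 ?(ltW t0)// lef_pV2 // posrE.
Qed.

(** The integrand may blow up at 0, so the fundamental theorem of calculus is applied on compact
    intervals away from 0 with primitive [t ^ s / s]. Each integral is at most [s^-1], and monotone
    convergence passes to the limit. *)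
Lemma integral_powR_lty (s : R) : 0 < s ->
  (\int[leb]_(t in `]0%R, 1%R]) (t `^ (s - 1))%:E < +oo)%E.
Proof.
move=> s0.
(* Starting at [n.+2] keeps the left endpoint strictly below 1, as the fundamental theorem of
   calculus requires. *)
pose F n : set R := `[n.+2%:R^-1, 1]%classic.
have FE : \bigcup_n F n = `]0%R, 1%R]%classic.
  apply/seteqP; split => [x [n _]|x]; rewrite /F/= in_itv/= => /andP[x0 x1].
    by rewrite in_itv/= x1 andbT (lt_le_trans _ x0).
  have [n nx] := ltr_add_invr x0; exists n => //=.
  rewrite in_itv/= x1 andbT; move: nx; rewrite add0r => /ltW; apply: le_trans.
  by rewrite lef_pV2 ?posrE// ler_nat.
have mpow A : measurable_fun A (fun t : R => (t `^ (s - 1))%:E).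
  by apply/measurable_EFinP; apply: measurable_funTS; exact: measurable_powR.
have nF : nondecreasing_seq F.
  move=> m n mn; apply/subsetPset => x; rewrite /F/= !in_itv/= => /andP[mx ->].
  rewrite andbT; apply: le_trans mx.
  by rewrite lef_pV2 ?posrE// ler_nat !ltnS.
have cF : (\int[leb]_(t in F i) (t `^ (s - 1))%:E)%E @[i --> \oo] -->
    (\int[leb]_(t in `]0%R, 1%R]) (t `^ (s - 1))%:E)%E.
  rewrite -FE; apply: ge0_nondecreasing_set_cvg_integral => //.
  - by move=> i; exact: measurable_itv.
  - by move=> i; exact: mpow.
  - by move=> i x _; rewrite lee_fin powR_ge0.
apply: (@le_lt_trans _ _ (s^-1)%:E); last exact: ltry.
move/cvg_lim : cF => <-//; apply: lime_le.
  apply: ereal_nondecreasing_is_cvgn => m n mn; apply: ge0_subset_integral => //.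
  - exact: measurable_itv.
  - exact: measurable_itv.
  - exact: mpow.
  - by move=> x _; rewrite lee_fin powR_ge0.
  - by apply/subsetPset; exact: nF.
apply: nearW => n.
have n0 : 0 < n.+2%:R^-1 :> R by [].
have n1 : n.+2%:R^-1 < 1 :> R by rewrite invf_lt1// ltr1n.
have cpow (a x : R) : 0 < x -> {for x, continuous (fun t : R => t `^ a)}.
  move=> x0; apply: differentiable_continuous; apply/derivable1_diffP.
  by apply: derivable_powR; rewrite in_itv/= x0.
have dF (x : R) : 0 < x ->
    is_derive x 1 (fun t : R => s^-1 * t `^ s) (x `^ (s - 1)).
  move=> x0; have dp := is_derive1_powR s x0.
  by apply: is_derive_eq; rewrite /GRing.scale/= mulrA mulVf ?gt_eqF// mul1r.
rewrite /F (@continuous_FTC2 _ _ (fun t => s^-1 * t `^ s))//.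
- rewrite powR1 mulr1 -EFinB lee_fin lerBlDr lerDl.
  by rewrite mulr_ge0 ?powR_ge0// invr_ge0 ltW.
- apply: continuous_in_subspaceT => x; rewrite inE/= in_itv/= => /andP[nx _].
  by apply: cpow; exact: lt_le_trans nx.
- split.
  + by move=> x; rewrite in_itv/= => /andP[nx _]; have /dF[] := lt_trans n0 nx.
  + apply: cvg_at_right_filter; apply: cvgMr; exact: cpow.
  + apply: cvg_at_left_filter; apply: cvgMr; exact: cpow.
- move=> x; rewrite in_itv/= => /andP[nx _].
  by rewrite derive1E; have /dF[] := lt_trans n0 nx.
Qed.

(* [1 + x <= expR x] at [x = t / 2s], raised to the power [s]. *)
Lemma powR_le_expR_half (s t : R) : 0 < s -> 0 <= t ->
  t `^ s <= (2 * s) `^ s * expR (t / 2).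
Proof.
move=> s0 t0.
have s20 : 0 < 2 * s by rewrite mulr_gt0.
have {1}-> : t = (2 * s) * (t / (2 * s)) by field; rewrite gt_eqF.
have ts0 : 0 <= t / (2 * s) by rewrite divr_ge0// ltW.
rewrite powRM ?(ltW s20)// ler_wpM2l ?powR_ge0//.
have -> : expR (t / 2) = expR (t / (2 * s)) `^ s.
  rewrite [RHS]/powR gt_eqF ?expR_gt0// expRK.
  by congr expR; field; rewrite gt_eqF.
apply: ge0_ler_powR; rewrite ?nnegrE ?expR_ge0 ?(ltW s0)//.
by rewrite (le_trans _ (expR_ge1Dx _))// lerDr.
Qed.

(** The integrand is dominated by [t ^ (s - 1)] on []0, 1]] and, beyond 1, by a multiple of the
    exponential density of rate 1/2, since there [t ^ (s - 1) <= t ^ s]. *)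
Lemma egamma_lty (s : R) : 0 < s -> (egamma s < +oo)%E.
Proof.
move=> s0.
(* The leading 2 cancels the rate 1/2 in the exponential density; the rest is the constant of
   [powR_le_expR_half]. *)
pose K : R := 2 * (2 * s) `^ s.
have K0 : 0 <= K by rewrite mulr_ge0// powR_ge0.
have mpow : measurable_fun setT (fun t : R => (t `^ (s - 1))%:E).
  by apply/measurable_EFinP; exact: measurable_powR.
have mexp : measurable_fun setT (fun t : R => (exponential_pdf 2^-1 t)%:E).
  by apply/measurable_EFinP; exact: measurable_exponential_pdf.
pose f1 : R -> \bar R := (fun t : R => (t `^ (s - 1))%:E) \_ `]0%R, 1%R].
have mf1 : measurable_fun setT f1.
  apply/(measurable_restrictT _ _).1 => //.
  exact: measurable_funTS.
have f10 t : (0 <= f1 t)%E.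
  by apply: erestrict_ge0 => x _; rewrite lee_fin powR_ge0.
have pdf0 t : 0 <= exponential_pdf 2^-1 t :> R by exact: exponential_pdf_ge0.
apply: (@le_lt_trans _ _
  (\int[leb]_t (f1 t + K%:E * (exponential_pdf 2^-1 t)%:E))%E).
  apply: ge0_le_integral => //.
  - by move=> t _; rewrite lee_fin gamma_density_ge0.
  - by apply/measurable_EFinP; exact: measurable_gamma_density.
  - by apply: emeasurable_funD => //; exact: measurable_funeM.
  move=> t _; rewrite /pospow; case: ifPn => t0; last first.
    by rewrite mul0r adde_ge0// mule_ge0// lee_fin.
  have [t1|t1] := leP t 1.
    rewrite /f1 patchE mem_set/= ?in_itv/= ?t0//.
    rewrite -[leLHS]adde0 leeD//; last by rewrite mule_ge0// lee_fin.
    by rewrite lee_fin ler_piMr ?powR_ge0// -expR0 ler_expR oppr_le0 ltW.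
  rewrite -[leLHS]add0e leeD//.
  rewrite -EFinM lee_fin exponential_pdfE ?(ltW t0)//.
  have -> : expR (- 2^-1 * t) = expR (t / 2) * expR (- t).
    by rewrite -expRD; congr expR; field.
  have -> : K * (2^-1 * (expR (t / 2) * expR (- t))) =
      ((2 * s) `^ s * expR (t / 2)) * expR (- t) by rewrite /K; field.
  rewrite ler_wpM2r ?expR_ge0//.
  apply: le_trans (powR_le_expR_half s0 (ltW t0)).
  by rewrite ler_powR ?(ltW t1)// gerBl.
rewrite ge0_integralD//; last 2 first.
- by move=> t _; rewrite mule_ge0// lee_fin.
- exact: measurable_funeM.
rewrite ge0_integralZl_EFin//; last by move=> t _; rewrite lee_fin.
rewrite integral_exponential_pdf// mule1 -integral_mkcond.
by rewrite lte_add_pinfty ?ltry// integral_powR_lty.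
Qed.

Lemma Gamma_egamma (s : R) : 0 < s -> egamma s = (Gamma s)%:E.
Proof.
move=> s0; rewrite /Gamma -egammaE fineK// ge0_fin_numE ?egamma_lty//.
by rewrite ltW ?egamma_gt0.
Qed.

Lemma Gamma_gt0 (s : R) : 0 < s -> 0 < Gamma s.
Proof. by move=> s0; rewrite -lte_fin -Gamma_egamma ?egamma_gt0. Qed.

(** The convolution of two cut-off powers; at [u = 1] it is Euler's beta integral. *)
Definition beta_conv (a b u : R) : \bar R :=
  (\int[leb]_x (pospow a x * pospow b (u - x))%:E)%E.

Lemma measurable_pospowB (b u : R) :
  measurable_fun setT (fun x : R => pospow b (u - x)).
Proof.
apply: measurableT_comp; first exact: measurable_pospow.
exact: measurable_funB.
Qed.

Lemma measurable_beta_density (a b u : R) :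
  measurable_fun setT (fun x : R => pospow a x * pospow b (u - x)).
Proof.
by apply: measurable_funM; [exact: measurable_pospow|exact: measurable_pospowB].
Qed.

Lemma beta_density_ge0 (a b u x : R) : 0 <= pospow a x * pospow b (u - x).
Proof. by rewrite mulr_ge0 ?pospow_ge0. Qed.

Lemma beta_conv_ge0 (a b u : R) : (0 <= beta_conv a b u)%E.
Proof. by apply: integral_ge0 => x _; rewrite lee_fin beta_density_ge0. Qed.

(** For [u > 0], substitute [u * x] for [x]. For [u <= 0] the factors are never both nonzero, so
    both sides vanish. *)
Lemma beta_conv_scale (a b u : R) :
  beta_conv a b u = ((pospow (a + b) u)%:E * beta_conv a b 1)%E.
Proof.
rewrite {1}/pospow; case: ifPn => u0; last first.
  rewrite mul0e; apply: integral0_eq => x _; rewrite /pospow.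
  case: ifPn => x0; last by rewrite mul0r.
  by rewrite subr_gt0 ifN ?mulr0// -leNgt (le_trans _ (ltW x0))// leNgt.
have mb : measurable_fun setT (fun x => (pospow a x * pospow b (u - x))%:E).
  by apply/measurable_EFinP; exact: measurable_beta_density.
rewrite {1}/beta_conv (ge0_integral_affine 0 u0 mb); last first.
  by move=> x; rewrite lee_fin beta_density_ge0.
(* The leading [u] is the Jacobian of the substitution. *)
have uE : u * (u `^ (a - 1) * u `^ (b - 1)) = u `^ (a + b - 1).
  have u00 (c : R) : (c == 0) ==> (u != 0) by rewrite (gt_eqF u0) implybT.
  rewrite -{1}(powRr1 (ltW u0)) -!powRD ?u00//; congr (_ `^ _); ring.
under eq_integral => x _.
  rewrite addr0 -{2}(mulr1 u) -mulrBr !pospow_scale//.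
  rewrite [X in X%:E](_ : _ = (u `^ (a - 1) * u `^ (b - 1)) *
    (pospow a x * pospow b (1 - x))); last by ring.
  rewrite EFinM; over.
rewrite ge0_integralZl_EFin//; last 3 first.
- by move=> x _; rewrite lee_fin beta_density_ge0.
- by apply/measurable_EFinP; exact: measurable_beta_density.
- by rewrite mulr_ge0 ?powR_ge0.
by rewrite muleA -EFinM uE.
Qed.

(* Tonelli on [x ^ (a - 1) (u - x) ^ (b - 1) exp (- u)], with [u = x + y]. *)
Lemma egammaM (a b : R) :
  (egamma a * egamma b = egamma (a + b) * beta_conv a b 1)%E.
Proof.
have eg0 s : (0 <= egamma s)%E.
  by apply: integral_ge0 => t _; rewrite lee_fin gamma_density_ge0.
pose h (x u : R) := pospow a x * pospow b (u - x) * expR (- u).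
have h0 x u : 0 <= h x u by rewrite mulr_ge0 ?expR_ge0// beta_density_ge0.
transitivity (\int[leb]_x \int[leb]_u (h x u)%:E)%E.
  rewrite /egamma -ge0_integralZr//; last 3 first.
  - by apply/measurable_EFinP; exact: measurable_gamma_density.
  - by move=> x _; rewrite lee_fin gamma_density_ge0.
  - exact: eg0.
  apply: eq_integral => x _.
  rewrite (@ge0_integral_affine _ 1 (- x))//; last 2 first.
  - by apply/measurable_EFinP; exact: measurable_gamma_density.
  - by move=> y; rewrite lee_fin gamma_density_ge0.
  rewrite mul1e -ge0_integralZl_EFin//; last 3 first.
  - by move=> y _; rewrite lee_fin gamma_density_ge0.
  - apply/measurable_EFinP.
    apply: (@measurableT_comp _ _ _ _ _ _ (fun t => pospow b t * expR (- t))).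
      exact: measurable_gamma_density.
    by apply: measurable_funD => //; exact: measurable_funM.
  - exact: gamma_density_ge0.
  apply: eq_integral => u _; rewrite -EFinM mul1r /h; congr (_%:E).
  have -> : expR (- u) = expR (- x) * expR (- (u - x)).
    by rewrite -expRD; congr expR; ring.
  ring.
transitivity (\int[leb]_u \int[leb]_x (h x u)%:E)%E.
  apply: (@fubini_tonelli _ _ (measurableTypeR R) (measurableTypeR R) R leb leb
    (fun p => (h p.1 p.2)%:E)); last first.
    by move=> p; rewrite lee_fin.
  apply/measurable_EFinP; apply: measurable_funM.
    apply: measurable_funM; apply: (measurableT_comp (measurable_pospow _)) => //.
    exact: measurable_funB.
  by do 2 apply: measurableT_comp => //.
rewrite /egamma -ge0_integralZr//; last 3 first.
- by apply/measurable_EFinP; exact: measurable_gamma_density.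
- by move=> x _; rewrite lee_fin gamma_density_ge0.
- exact: beta_conv_ge0.
apply: eq_integral => u _.
under eq_integral do rewrite /h EFinM.
rewrite ge0_integralZr//; last 2 first.
- by apply/measurable_EFinP; exact: measurable_beta_density.
- by move=> x _; rewrite lee_fin beta_density_ge0.
by rewrite -/(beta_conv a b u) beta_conv_scale EFinM -!muleA (muleC (expR _)%:E).
Qed.

Lemma beta_convE (a b u : R) : 0 < a -> 0 < b ->
  beta_conv a b u = (pospow (a + b) u * (Gamma a * Gamma b / Gamma (a + b)))%:E.
Proof.
move=> a0 b0; rewrite beta_conv_scale EFinM; congr (_ * _)%E.
have := egammaM a b; rewrite !Gamma_egamma ?addr_gt0// -EFinM.
have G0 := Gamma_gt0 (addr_gt0 a0 b0).
(* An infinite beta integral would make the finite product [Gamma a * Gamma b] infinite; a finite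
   one is found by division. *)
case: (beta_conv a b 1) (beta_conv_ge0 a b 1) => [r _|_|//].
  by rewrite -EFinM => -[->]; congr (_%:E); field; rewrite gt_eqF.
by rewrite mulry gtr0_sg// mul1e.
Qed.
End euler_integrals.

(** * Functionals that behave like integrals of nonnegative functions *)

Section integral_functional.
Context {R : realType}.
Local Open Scope ereal_scope.

Definition nnmeas {d} {T : measurableType d} (f : T -> \bar R) : Prop :=
  measurable_fun setT f /\ forall x, 0 <= f x.

(* Such a functional is determined by its values on indicators
   ([eq_integral_functional]).  This compares the iterated integral [lebInt]
   with expectations, and yields products of independent expectations, without
   product measures on tuples. *)
Record integral_functional {d} {T : measurableType d}
    (I : (T -> \bar R) -> \bar R) : Prop := IntegralFunctional {
  ifun_ge0 : forall f, nnmeas f -> 0 <= I f ;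
  ifun_D : forall f g, nnmeas f -> nnmeas g -> I (f \+ g) = I f + I g ;
  ifunZ : forall (k : R) f, (0 <= k)%R -> nnmeas f ->
    I (fun x => k%:E * f x) = k%:E * I f ;
  ifun_lim : forall g : (T -> \bar R)^nat, (forall n, nnmeas (g n)) ->
    (forall x, nondecreasing_seq (g ^~ x)) ->
    I (fun x => limn (g ^~ x)) = limn (fun n => I (g n)) }.

Section basic.
Context {d} {T : measurableType d}.
Implicit Types (f g : T -> \bar R) (A : set T).

Lemma nnmeas_indic A : measurable A -> nnmeas (fun x => (\1_A x)%:E).
Proof.
move=> mA; split=> [|x]; last by rewrite lee_fin.
by apply/measurable_EFinP; exact: measurable_indic.
Qed.

Lemma nnmeasZ (k : R) f : (0 <= k)%R -> nnmeas f -> nnmeas (fun x => k%:E * f x).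
Proof.
move=> k0 [mf f0]; split=> [|x]; first exact: measurable_funeM.
by rewrite mule_ge0// lee_fin.
Qed.

Lemma nnmeasD f g : nnmeas f -> nnmeas g -> nnmeas (f \+ g).
Proof.
move=> [mf f0] [mg g0]; split=> [|x]; first exact: emeasurable_funD.
by rewrite adde_ge0.
Qed.

Lemma nnmeasM f g : nnmeas f -> nnmeas g -> nnmeas (f \* g).
Proof.
move=> [mf f0] [mg g0]; split=> [|x]; first exact: emeasurable_funM.
by rewrite mule_ge0.
Qed.

Lemma nnmeas0 : nnmeas (fun _ : T => 0).
Proof. by split. Qed.

Lemma nnmeas_comp {d'} {U : measurableType d'} (phi : U -> T) f :
  measurable_fun setT phi -> nnmeas f -> nnmeas (f \o phi).
Proof. by move=> mphi [mf f0]; split => [|x]/=; [exact: measurableT_comp|]. Qed.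

Lemma ifun0 I : @integral_functional d T I -> I (fun=> 0) = 0.
Proof.
move=> hI; have := ifunZ hI (lexx 0%R) nnmeas0.
by under [X in I X]eq_fun do rewrite mul0e; rewrite mul0e.
Qed.

Lemma ifun_sum I (s : seq R) (F : R -> T -> \bar R) : integral_functional I ->
  (forall r, nnmeas (F r)) ->
  nnmeas (fun x => \sum_(r <- s) F r x) /\
  I (fun x => \sum_(r <- s) F r x) = \sum_(r <- s) I (F r).
Proof.
move=> hI mF; elim: s => [|r s [mS IS]].
  have -> : (fun x : T => \sum_(r <- [::]) F r x) = fun=> 0.
    by apply/funext => x; rewrite big_nil.
  by rewrite big_nil (ifun0 hI); split => //; exact: nnmeas0.
have -> : (fun x : T => \sum_(r <- r :: s) F r x) =
    F r \+ (fun x => \sum_(r <- s) F r x).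
  by apply/funext => x; rewrite big_cons.
split; first exact: nnmeasD.
by rewrite (ifun_D hI)// IS big_cons.
Qed.

Import HBNNSimple.

(** A nonnegative measurable function is an increasing limit of simple functions, each a finite
    nonnegative combination of indicators; the axioms carry the agreement through sums, multiples
    and limits. *)
Lemma eq_integral_functional I J f :
  @integral_functional d T I -> integral_functional J ->
  (forall A, measurable A -> I (fun x => (\1_A x)%:E) = J (fun x => (\1_A x)%:E)) ->
  nnmeas f -> I f = J f.
Proof.
move=> hI hJ IJ [mf f0].
pose g := nnsfun_approx measurableT mf.
have fE : f = fun x => limn (fun n => (g n x)%:E).
  apply/funext => x; apply/esym/cvg_lim => //.
  by apply: (cvg_nnsfun_approx measurableT mf).
have mg n : nnmeas (fun x => (g n x)%:E).
  by split=> [|x]; [exact/measurable_EFinP|rewrite lee_fin].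
have ndg x : nondecreasing_seq (fun n => (g n x)%:E).
  by move=> m n mn; rewrite lee_fin; exact/lefP/nd_nnsfun_approx.
rewrite fE (ifun_lim hI mg ndg) (ifun_lim hJ mg ndg).
congr (limn _); apply/funext => n.
pose s : seq R := finmap.enum_fset (fset_set (range (g n))).
(* [ifun_sum] asks for nonnegativity at every real [r], hence the truncation; it changes nothing at
   the values [g n] really takes. *)
pose F (r : R) (x : T) : \bar R :=
  (Num.max r 0)%:E * (\1_(g n @^-1` [set r]) x)%:E.
have mpre r : measurable (g n @^-1` [set r]) by [].
have max0 (r : R) : (0 <= Num.max r 0)%R by rewrite le_max lexx orbT.
have mF r : nnmeas (F r) by exact/nnmeasZ/nnmeas_indic.
have gE : (fun x => (g n x)%:E) = fun x => \sum_(r <- s) F r x.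
  apply/funext => x; rewrite fimfunE -fsumEFin// fsbig_finite//=.
  rewrite /s big_seq [RHS]big_seq; apply: eq_bigr => r.
  rewrite in_fset_set// inE => -[y _ <-].
  by rewrite /F EFinM max_l.
rewrite gE (ifun_sum _ hI mF).2 (ifun_sum _ hJ mF).2; apply: eq_bigr => r _.
have hA := nnmeas_indic (mpre r).
by rewrite /F (ifunZ hI)// (ifunZ hJ)// IJ.
Qed.
End basic.

Lemma integral_functional_integral d (T : measurableType d)
    (mu : {measure set T -> \bar R}) :
  integral_functional (fun f => \int[mu]_x f x).
Proof.
split.
- by move=> f [mf f0]; exact: integral_ge0.
- by move=> f g [mf f0] [mg g0]; exact: ge0_integralD.
- by move=> k f k0 [mf f0]; exact: ge0_integralZl_EFin.
- move=> g mg ndg; apply: monotone_convergence => //.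
  + by move=> n; have [] := mg n.
  + by move=> n x _; have [_] := mg n.
Qed.

(** Closure under image and density at once: [phi] will be a random vector or the simplex
    parametrization, and [w] a density or the product of the remaining factors. *)
Lemma integral_functional_weight {d d'} {T : measurableType d}
    {U : measurableType d'} (I : (T -> \bar R) -> \bar R) (phi : T -> U)
    (w : T -> R) :
  integral_functional I -> measurable_fun setT phi ->
  measurable_fun setT w -> (forall x, 0 <= w x)%R ->
  integral_functional (fun f => I (fun x => f (phi x) * (w x)%:E)).
Proof.
move=> hI mphi mw w0.
have mEw : nnmeas (fun x => (w x)%:E).
  by split=> [|x]; [exact/measurable_EFinP|rewrite lee_fin].
have mc f : nnmeas f -> nnmeas (fun x => f (phi x) * (w x)%:E).
  by move=> mf; exact: (nnmeasM (nnmeas_comp mphi mf) mEw).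
split.
- by move=> f mf; apply: (ifun_ge0 hI); exact: mc.
- move=> f g mf mg; rewrite -(ifun_D hI (mc _ mf) (mc _ mg)).
  by congr I; apply/funext => x /=; rewrite ge0_muleDl// ; [exact: mf.2|exact: mg.2].
- move=> k f k0 mf; rewrite -(ifunZ hI k0 (mc _ mf)).
  by congr I; apply/funext => x /=; rewrite muleA.
- move=> g mg ndg; rewrite -(ifun_lim hI)//; last 2 first.
  + by move=> n; exact: mc.
  + by move=> x m n mn; rewrite lee_wpmul2r ?lee_fin//; exact: ndg.
  congr I; apply/funext => x; rewrite limeMr//.
  by apply: ereal_nondecreasing_is_cvgn; exact: ndg.
Qed.

End integral_functional.

(** * The iterated Lebesgue integral as an integral functional *)

Section lebInt.
Context {R : realType}.
Local Open Scope ereal_scope.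
Local Notation leb := (@lebesgue_measure R).

Lemma lebInt_ge0 m (f : m.-tuple R -> \bar R) :
  (forall x, 0 <= f x) -> 0 <= lebInt f.
Proof.
elim: m f => [|m IHm] f f0; first exact: f0.
by apply: integral_ge0 => x _; exact: IHm.
Qed.

(** The parameter space [T] is arbitrary so that the induction on [m] can move the first coordinate
    into it; Tonelli's theorem then handles the outer integral. *)
Lemma measurable_lebInt m d (T : measurableType d)
    (f : T -> m.-tuple R -> \bar R) :
  measurable_fun setT (fun p : T * m.-tuple R => f p.1 p.2) ->
  (forall x t, 0 <= f x t) ->
  measurable_fun setT (fun x => lebInt (f x)).
Proof.
elim: m d T f => [|m IHm] d T f mf f0 /=.
  have mpair : measurable_fun setT (fun x : T => (x, [tuple] : 0.-tuple R)).
    exact: measurable_fun_pair.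
  exact: (measurableT_comp mf mpair).
pose g (p : T * measurableTypeR R) :=
  lebInt (fun t : m.-tuple R => f p.1 (cons_tuple p.2 t)).
apply: (@measurable_fun_fubini_tonelli_F _ _ T (measurableTypeR R) R leb g);
  last by move=> p; exact: lebInt_ge0.
apply: IHm => //.
have mcons : measurable_fun setT
    (fun q : (T * measurableTypeR R) * m.-tuple R =>
      (q.1.1, cons_tuple q.1.2 q.2 : m.+1.-tuple R)).
  apply: measurable_fun_pair; first exact: measurableT_comp.
  by apply: measurable_cons => //; exact: measurableT_comp.
exact: (measurableT_comp mf mcons).
Qed.

Lemma measurable_cons_tuple m (x : R) :
  measurable_fun setT (fun t : m.-tuple R => cons_tuple x t).
Proof. exact: measurable_cons. Qed.

Lemma nnmeas_lebInt_cons m (f : m.+1.-tuple R -> \bar R) : nnmeas f ->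
  nnmeas (fun x : measurableTypeR R =>
    lebInt (fun t : m.-tuple R => f (cons_tuple x t))).
Proof.
move=> [mf f0]; split=> [|x]; last by apply: lebInt_ge0 => t.
apply: (@measurable_lebInt m _ (measurableTypeR R)
   (fun x t => f (cons_tuple x t))) => //.
by apply: (measurableT_comp mf); exact: measurable_cons.
Qed.

Lemma le_lebInt m (f g : m.-tuple R -> \bar R) : nnmeas f -> nnmeas g ->
  (forall x, f x <= g x) -> lebInt f <= lebInt g.
Proof.
elim: m f g => [|m IHm] f g mf mg fg; first exact: fg.
have [mf' f'0] := nnmeas_lebInt_cons mf.
have [mg' g'0] := nnmeas_lebInt_cons mg.
apply: ge0_le_integral => // x _.
have mc := @measurable_cons_tuple m x.
apply: (IHm _ _ (nnmeas_comp mc mf) (nnmeas_comp mc mg)) => t.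
exact: fg.
Qed.

Lemma integral_functional_lebInt m :
  integral_functional (@lebInt R m).
Proof.
elim: m => [|m IHm].
  split => //=.
  - by move=> f [_ f0].
have mc (f : m.+1.-tuple R -> \bar R) x : nnmeas f ->
    nnmeas (fun t : m.-tuple R => f (cons_tuple x t)).
  by move=> mf; exact: (nnmeas_comp (@measurable_cons_tuple m x) mf).
have hleb := integral_functional_integral leb.
split => /=.
- by move=> f [_ f0]; exact: (@lebInt_ge0 m.+1).
- move=> f g mf mg; rewrite -(ifun_D hleb); try exact: nnmeas_lebInt_cons.
  by congr integral; apply/funext => x /=; rewrite -(ifun_D IHm)//; exact: mc.
- move=> k f k0 mf; rewrite -(ifunZ hleb)//; last exact: nnmeas_lebInt_cons.
  by congr integral; apply/funext => x /=; rewrite -(ifunZ IHm)//; exact: mc.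
- move=> g mg ndg.
  rewrite -(ifun_lim hleb); last 2 first.
  + by move=> n; exact: nnmeas_lebInt_cons.
  + by move=> x a b ab; apply: le_lebInt; try exact: mc; move=> t; exact: ndg.
  congr integral; apply/funext => x; rewrite (ifun_lim IHm)//.
  by move=> n; exact: mc.
Qed.
End lebInt.

(** * Dirichlet's integral and the Dirichlet density *)

Section dirichlet_integral.
Context {R : realType}.

(** The unnormalized density on the simplex of total mass [u], with [c] the parameter of the
    eliminated coordinate. A free [u] is what makes the induction possible. *)
Definition dirichlet_kernel m (c u : R) (a : 'I_m -> R) (y : m.-tuple R) : R :=
  pospow c (u - \sum_i tnth y i) * \prod_i pospow (a i) (tnth y i).

Lemma dirichlet_kernel_ge0 m c u (a : 'I_m -> R) y :
  0 <= dirichlet_kernel c u a y.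
Proof.
by rewrite mulr_ge0 ?pospow_ge0// prodr_ge0// => i _; exact: pospow_ge0.
Qed.

Lemma measurable_dirichlet_kernel m c u (a : 'I_m -> R) :
  measurable_fun setT (dirichlet_kernel c u a).
Proof.
apply: measurable_funM.
  apply: measurableT_comp; first exact: measurable_pospow.
  apply: measurable_funB => //; apply: measurable_sum => i.
  exact: measurable_tnth.
apply: measurable_prod => i _.
apply: measurableT_comp; first exact: measurable_pospow.
exact: measurable_tnth.
Qed.

Lemma nnmeas_dirichlet_kernel m c u (a : 'I_m -> R) :
  nnmeas (fun y => (dirichlet_kernel c u a y)%:E).
Proof.
split; first by apply/measurable_EFinP; exact: measurable_dirichlet_kernel.
by move=> y; rewrite lee_fin dirichlet_kernel_ge0.
Qed.

(** Fixing the first coordinate at [x] leaves the same kernel with mass [u - x]. By induction it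
    integrates to a power of [u - x], and the outer integral is then a beta convolution. *)
Lemma lebInt_dirichlet_kernel m c u (a : 'I_m -> R) :
  0 < c -> (forall i, 0 < a i) ->
  lebInt (fun y => (dirichlet_kernel c u a y)%:E) =
  (pospow (c + \sum_i a i) u *
    (Gamma c * \prod_i Gamma (a i) / Gamma (c + \sum_i a i)))%:E.
Proof.
elim: m c u a => [|m IHm] c u a c0 a0 /=.
  rewrite /dirichlet_kernel !big_ord0 !mulr1 subr0 addr0.
  by rewrite divff ?mulr1// gt_eqF// Gamma_gt0.
pose a' i := a (lift ord0 i).
have a'0 i : 0 < a' i by exact: a0.
set K := Gamma c * \prod_i Gamma (a' i) / Gamma (c + \sum_i a' i).
have ca0 : 0 < c + \sum_i a' i.
  by rewrite ltr_wpDr// sumr_ge0// => i _; exact: ltW.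
have K0 : 0 <= K.
  rewrite divr_ge0 ?mulr_ge0 ?ltW ?Gamma_gt0// prodr_gt0// => i _.
  exact: Gamma_gt0.
transitivity (\int[@lebesgue_measure R]_x (K%:E *
    (pospow (a ord0) x * pospow (c + \sum_i a' i) (u - x))%:E))%E.
  apply: eq_integral => x _.
  transitivity (lebInt (fun t : m.-tuple R =>
      ((pospow (a ord0) x)%:E * (dirichlet_kernel c (u - x) a' t)%:E)%E)).
    congr lebInt; apply/funext => t; rewrite -EFinM; congr (_%:E).
    have tE i : tnth (cons_tuple x t) (lift ord0 i) = tnth t i by exact: tnthS.
    rewrite /dirichlet_kernel !big_ord_recl tnth0 opprD addrA mulrCA.
    rewrite (eq_bigr (tnth t)) => [|i _]; last exact: tE.
    by congr (_ * (_ * _)); apply: eq_bigr => i _; rewrite tE.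
  rewrite (ifunZ (integral_functional_lebInt m) (pospow_ge0 _ _)); last first.
    exact: nnmeas_dirichlet_kernel.
  by rewrite IHm// -!EFinM; congr (_%:E); rewrite -/K; ring.
rewrite ge0_integralZl_EFin//; last 2 first.
- by move=> x _; rewrite lee_fin beta_density_ge0.
- by apply/measurable_EFinP; exact: measurable_beta_density.
rewrite -/(beta_conv (a ord0) (c + \sum_i a' i) u) beta_convE//.
rewrite -EFinM; congr (_%:E).
have -> : \sum_i a i = a ord0 + \sum_i a' i by rewrite big_ord_recl.
have -> : \prod_i Gamma (a i) = Gamma (a ord0) * \prod_i Gamma (a' i).
  by rewrite big_ord_recl.
rewrite (addrCA c) /K.
have := Gamma_gt0 ca0.
have := Gamma_gt0 (addr_gt0 (a0 ord0) ca0).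
move: (Gamma (c + _)) (Gamma (a ord0 + _)) => G1 G2 G20 G10.
by field; rewrite !gt_eqF.
Qed.

(** A single nonpositive coordinate annihilates the product, which therefore encodes the support
    condition. *)
Lemma dirichlet_densityE k (a : 'I_k.+1 -> R) (x : k.+1.-tuple R) :
  dirichlet_density a x = (\prod_i pospow (a i) (tnth x i)) / mBeta a.
Proof.
rewrite /dirichlet_density; case: ifPn => [/forallP x0|].
  by congr (_ / _); apply: eq_bigr => i _; rewrite /pospow x0.
rewrite negb_forall => /existsP[i xi].
by rewrite (bigD1 i)//= {1}/pospow (negbTE xi) !mul0r.
Qed.

Lemma prod_pospow_simplex_pt k (a : 'I_k.+1 -> R) (y : k.-tuple R) :
  \prod_i pospow (a i) (tnth (simplex_pt y) i) =
  dirichlet_kernel (a ord0) 1 (fun i => a (lift ord0 i)) y.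
Proof.
rewrite big_ord_recl /simplex_pt tnth0; congr (_ * _).
by apply: eq_bigr => i _; congr pospow; exact: tnthS.
Qed.

Lemma lebInt_prod_pospow k (a : 'I_k.+1 -> R) : (forall i, 0 < a i) ->
  lebInt (fun y : k.-tuple R =>
    (\prod_i pospow (a i) (tnth (simplex_pt y) i))%:E) = (mBeta a)%:E.
Proof.
move=> a0.
under [X in lebInt X]eq_fun do rewrite prod_pospow_simplex_pt.
rewrite lebInt_dirichlet_kernel// /pospow ltr01 powR1 mul1r.
by rewrite /mBeta !big_ord_recl.
Qed.

Lemma mBeta_gt0 k (a : 'I_k.+1 -> R) : (forall i, 0 < a i) -> 0 < mBeta a.
Proof.
move=> a0; rewrite divr_gt0//.
  by rewrite prodr_gt0// => i _; exact: Gamma_gt0.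
rewrite Gamma_gt0// big_ord_recl ltr_pwDl// sumr_ge0// => i _.
exact: ltW.
Qed.

Lemma dirichlet_density_ge0 k (a : 'I_k.+1 -> R) x : (forall i, 0 < a i) ->
  0 <= dirichlet_density a x.
Proof.
move=> a0; rewrite dirichlet_densityE divr_ge0 ?(ltW (mBeta_gt0 a0))//.
by rewrite prodr_ge0// => i _; exact: pospow_ge0.
Qed.

Lemma measurable_simplex_pt k :
  measurable_fun setT (@simplex_pt R k).
Proof.
apply: measurable_cons => //; apply: measurable_funB => //.
by apply: measurable_sum => i; exact: measurable_tnth.
Qed.

Lemma measurable_dirichlet_density k (a : 'I_k.+1 -> R) :
  measurable_fun setT (fun y : k.-tuple R => dirichlet_density a (simplex_pt y)).
Proof.
under eq_fun do rewrite dirichlet_densityE prod_pospow_simplex_pt.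
by apply: measurable_funM => //; exact: measurable_dirichlet_kernel.
Qed.

End dirichlet_integral.

(** * Expectations under Dirichlet laws and under independence *)

Section expectation.
Context {R : realType} {d} {Omega : measurableType d} {P : probability Omega R}.

Lemma integral_indic_comp {d'} {U : measurableType d'} (Y : Omega -> U) A :
  measurable_fun setT Y -> measurable A ->
  (\int[P]_w (\1_A (Y w))%:E = P (Y @^-1` A))%E.
Proof.
move=> mY mA; rewrite -[in RHS](setIT (Y @^-1` A)) -integral_indic//.
by rewrite -[X in measurable X]setTI; exact: mY.
Qed.

(** The hypothesis on the law is this equality for indicators, and both sides are integral
    functionals of [h]. *)
Lemma dirichlet_expectation k (a : 'I_k.+1 -> R) (Y : Omega -> k.+1.-tuple R)
    (h : k.+1.-tuple R -> R) :
  (forall i, 0 < a i) -> measurable_fun setT Y -> has_dirichlet_law P a Y ->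
  measurable_fun setT h -> (forall x, 0 <= h x) ->
  (\int[P]_w (h (Y w))%:E)%E =
  lebInt (fun y : k.-tuple R =>
    (h (simplex_pt y) * dirichlet_density a (simplex_pt y))%:E).
Proof.
move=> a0 mY YP mh h0.
(* The weight 1 brings the expectation into the form of [integral_functional_weight]. *)
pose I f := (\int[P]_w (f (Y w) * 1%:E))%E.
pose J (f : k.+1.-tuple R -> \bar R) := lebInt (fun y : k.-tuple R =>
  (f (simplex_pt y) * (dirichlet_density a (simplex_pt y))%:E)%E).
have hI : integral_functional I.
  apply: (@integral_functional_weight _ _ _ _ _ _ Y (fun=> 1)) => //.
  exact: integral_functional_integral.
have hJ : integral_functional J.
  apply: (@integral_functional_weight _ _ _ _ _ _ (@simplex_pt R k)
    (fun y => dirichlet_density a (simplex_pt y))) => //.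
  - exact: integral_functional_lebInt.
  - exact: measurable_simplex_pt.
  - exact: measurable_dirichlet_density.
  - by move=> y; exact: dirichlet_density_ge0.
have := eq_integral_functional (f := fun x => (h x)%:E) hI hJ.
rewrite /I /J; under eq_integral do rewrite mule1.
apply.
- move=> A mA; rewrite -[RHS]YP//.
  by under eq_integral do rewrite mule1; exact: integral_indic_comp.
- by split=> [|x]; [exact/measurable_EFinP|rewrite lee_fin].
Qed.

(* The factors are turned from indicators into general functions one at a time:
   with the others fixed, both sides are integral functionals of [G l0]. *)
Lemma independent_expectation_prod n k (X : 'I_n -> Omega -> k.+1.-tuple R)
    (G : 'I_n -> k.+1.-tuple R -> R) (e : 'I_n -> R) :
  (forall l, measurable_fun setT (X l)) -> mutually_independent P X ->
  (forall l, measurable_fun setT (G l)) -> (forall l x, 0 <= G l x) ->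
  (forall l, \int[P]_w (G l (X l w))%:E = (e l)%:E)%E ->
  (\int[P]_w (\prod_l G l (X l w))%:E = (\prod_l e l)%:E)%E.
Proof.
move=> mX indX mG G0 Ge.
(* Induction on [m], where the factors of index at least [m] are still indicators: [m = 0] is the
   definition of independence, [m = n] the claim. *)
suff H m : forall (G : 'I_n -> k.+1.-tuple R -> R) (e : 'I_n -> R),
    (forall l, measurable_fun setT (G l)) -> (forall l x, 0 <= G l x) ->
    (forall l, \int[P]_w (G l (X l w))%:E = (e l)%:E)%E ->
    (forall l : 'I_n, (m <= l)%N -> exists2 A, measurable A & G l = \1_A) ->
    (\int[P]_w (\prod_l G l (X l w))%:E = (\prod_l e l)%:E)%E.
  by apply: (H n) => // l; rewrite leqNgt ltn_ord.
have mXA l A : measurable A -> measurable (X l @^-1` A).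
  by move=> mA; rewrite -[X in measurable X]setTI; exact: mX.
elim: m {G e mG G0 Ge} => [|m IHm] G e mG G0 Ge GA.
  pose A l := sval (cid2 (GA l (leq0n l))).
  have mA l : measurable (A l) by rewrite /A; case: cid2.
  have GE l : G l = \1_(A l) by rewrite /A; case: cid2.
  have PA l : P (X l @^-1` A l) = (e l)%:E.
    by rewrite -Ge GE integral_indic_comp.
  have -> : (\prod_l e l)%:E = (\prod_l P (X l @^-1` A l))%E.
    by rewrite -prodEFin; apply: eq_bigr => l _; rewrite PA.
  rewrite -indX// -[in RHS](setIT (\bigcap_(l in _) _)) -integral_indic//; last first.
    by apply: fin_bigcap_measurable => // l _; exact: mXA.
  apply: eq_integral => w _; congr (_%:E).
  rewrite indicE; have [/set_mem wA|wA] := boolP (_ \in _).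
    by rewrite big1// => l _; rewrite GE indicE mem_set//; exact: wA.
  have /existsNP[l wAl] : ~ forall l, A l (X l w).
    by move=> wA'; move/negP : wA; apply; rewrite inE => l _; exact: wA'.
  by rewrite (bigD1 l)//= GE indicE memNset// mul0r.
(* If [n <= m], no index is at least [m] and the condition on indicators is vacuous. *)
have [nm|mn] := leqP n m.
  apply: IHm => // l ml; move: (ltn_ord l).
  by rewrite ltnNge (leq_trans nm ml).
pose l0 := Ordinal mn.
pose W w := \prod_(l | l != l0) G l (X l w).
pose c := \prod_(l | l != l0) e l.
have mGX l : measurable_fun setT (fun w => G l (X l w)) by exact: measurableT_comp.
have mW : measurable_fun setT W.
  have -> : W = fun w => \prod_l (if l != l0 then G l (X l w) else 1).
    by apply/funext => w; rewrite /W big_mkcond.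
  by apply: measurable_prod => l _; case: (l != l0).
have W0 w : 0 <= W w by rewrite prodr_ge0.
have e0 l : 0 <= e l.
  by rewrite -lee_fin -Ge integral_ge0// => w _; rewrite lee_fin.
have c0 : 0 <= c by rewrite prodr_ge0.
pose I f := (\int[P]_w (f (X l0 w) * (W w)%:E))%E.
(* Compared with [I], the product of the other factors is replaced by the product of their
   expectations. *)
pose J f := (\int[P]_w (f (X l0 w) * c%:E))%E.
have hI : integral_functional I.
  apply: (@integral_functional_weight _ _ _ _ _ _ (X l0) W) => //.
  exact: integral_functional_integral.
have hJ : integral_functional J.
  apply: (@integral_functional_weight _ _ _ _ _ _ (X l0) (fun=> c)) => //.
  exact: integral_functional_integral.
have := eq_integral_functional (f := fun x => (G l0 x)%:E) hI hJ.
rewrite /I /J => IJ.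
under eq_integral do rewrite (bigD1 l0)//= -/(W _) EFinM.
rewrite IJ.
- rewrite ge0_integralZr//; last 2 first.
  + exact/measurable_EFinP.
  + by move=> w _; rewrite lee_fin.
  by rewrite Ge -EFinM (bigD1 l0).
- move=> B mB.
  (* With an indicator at [l0], all factors from index [m] on are indicators, so the induction
     hypothesis applies. *)
  pose G' l := if l == l0 then \1_B else G l.
  pose p := fine (P (X l0 @^-1` B)).
  pose e' l := if l == l0 then p else e l.
  have PB : (\int[P]_w (\1_B (X l0 w))%:E)%E = p%:E.
    rewrite fineK; last by apply: fin_num_measure; exact: mXA.
    exact: integral_indic_comp.
  have := IHm G' e'.
  under eq_integral => w _.
    rewrite (bigD1 l0)//= {1}/G' eqxx.
    rewrite (eq_bigr (fun l => G l (X l w))); last first.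
      by move=> l /negbTE ll0; rewrite /G' ll0.
    rewrite EFinM -/(W w); over.
  move=> ->.
  + rewrite ge0_integralZr//; last first.
      exact: (nnmeas_comp (mX l0) (nnmeas_indic mB)).1.
    rewrite PB -EFinM (bigD1 l0)//= {1}/e' eqxx; congr (_ * _)%:E.
    by apply: eq_bigr => l /negbTE ll0; rewrite /e' ll0.
  + by move=> l; rewrite /G'; case: ifP => // _; exact: measurable_indic.
  + by move=> l x; rewrite /G'; case: ifP.
  + by move=> l; rewrite /G' /e'; case: eqP => [->|].
  + move=> l ml; rewrite /G'; case: eqP => [_|/eqP ll0]; first by exists B.
    by apply: GA; rewrite ltn_neqAle ml andbT eq_sym.
- by split=> [|x]; [exact/measurable_EFinP|rewrite lee_fin].
Qed.

End expectation.

(** * The likelihood ratio and the AM-GM inequality *)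

Section likelihood_ratio.
Context {R : realType}.

Lemma powR_prod (I : finType) (F : I -> R) (t : R) : (forall i, 0 <= F i) ->
  (\prod_i F i) `^ t = \prod_i F i `^ t.
Proof.
(* Nonnegativity of the partial products is carried along because [powRM] requires it. *)
move=> F0; suff [] : 0 <= \prod_i F i /\ (\prod_i F i) `^ t = \prod_i F i `^ t.
  by [].
elim/big_ind2 : _ => [|a a' b b' [a0 <-] [b0 <-]|i _]; rewrite ?powR1//.
by rewrite mulr_ge0// powRM.
Qed.

Lemma prod_ord_gt0 k (F : 'I_k.+1 -> R) :
  \prod_(i < k.+1 | (0 < i)%N) F i = \prod_(j < k) F (lift ord0 j).
Proof. by rewrite big_mkcond big_ord_recl /= mul1r. Qed.

(** The product is [(\prod_l (z / x l)) ^ t]. By AM-GM, [\prod_l x l] is at most the [n]-th power of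
    the mean, hence at most [z ^ n], so the base is at least 1. *)
Lemma le_mean_prod_div n (x : 'I_n -> R) (z t : R) : 0 < z -> 0 <= t ->
  (0 < n)%N -> (forall l, 0 < x l) -> n%:R^-1 * \sum_l x l <= z ->
  1 <= \prod_l (z `^ t * x l `^ (- t)).
Proof.
move=> z0 t0 n0 x0 xz.
have xt l : z `^ t * x l `^ (- t) = (z / x l) `^ t.
  rewrite powRM ?(ltW z0) ?invr_ge0 ?(ltW (x0 l))//.
  by rewrite -powR_inv1 ?(ltW (x0 l))// -powRrM mulN1r.
under eq_bigr do rewrite xt.
rewrite -powR_prod => [|l]; last by rewrite divr_ge0 ?ltW.
suff z1 : 1 <= \prod_l (z / x l).
  by rewrite -[leLHS](powRr0 (\prod_l (z / x l))) ler_powR.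
have px0 : 0 < \prod_l x l by rewrite prodr_gt0.
rewrite prodf_div prodr_const card_ord ler_pdivlMr// mul1r.
have := (leif_AGM (A := 'I_n) (E := x) (fun l _ => ltW (x0 l))).1.
rewrite /= card_ord => /le_trans; apply.
rewrite lerXn2r ?nnegrE ?(ltW z0)//; last by rewrite mulrC.
by rewrite divr_ge0// sumr_ge0// => l _; exact: ltW.
Qed.

Lemma measurable_pos_tuple m :
  measurable [set x : m.-tuple R | forall i, 0 < tnth x i].
Proof.
have -> : [set x : m.-tuple R | forall i, 0 < tnth x i] =
    \bigcap_(i in [set: 'I_m]) ((fun x => tnth x i) @^-1` `]0, +oo[).
  apply/seteqP; split => x /= x0 i; first by move=> _ /=; rewrite in_itv/= x0.
  by have := x0 i I; rewrite /= in_itv/= andbT.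
apply: fin_bigcap_measurable => // i _.
by rewrite -[X in measurable X]setTI; exact: measurable_tnth.
Qed.

(* For [t = a - b] with [b ord0 = a ord0], this is the density of Dirichlet(b)
   over that of Dirichlet(a), normalized to be 1 at [z]. *)
Definition tilt k (z t : 'I_k.+1 -> R) (x : k.+1.-tuple R) : R :=
  \prod_(j < k) (z (lift ord0 j) `^ t (lift ord0 j) *
                 tnth x (lift ord0 j) `^ (- t (lift ord0 j))).

Lemma tilt_ge0 k (z t : 'I_k.+1 -> R) x : 0 <= tilt z t x.
Proof. by rewrite prodr_ge0// => j _; rewrite mulr_ge0 ?powR_ge0. Qed.

Lemma measurable_tilt k (z t : 'I_k.+1 -> R) : measurable_fun setT (tilt z t).
Proof.
apply: measurable_prod => j _; apply: measurable_funM => //.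
apply: (measurableT_comp (measurable_powR _)); exact: measurable_tnth.
Qed.

(** In each coordinate of positive index the exponents add up to [- (a - b) + (a - 1) = b - 1].
    Coordinate 0 is not tilted, which is why [b] and [a] must agree there. *)
Lemma tilt_density k (a b z : 'I_k.+1 -> R) (x : k.+1.-tuple R) :
  b ord0 = a ord0 ->
  tilt z (fun i => a i - b i) x * dirichlet_density a x =
  (\prod_(j < k) z (lift ord0 j) `^ (a (lift ord0 j) - b (lift ord0 j)) / mBeta a) *
    \prod_i pospow (b i) (tnth x i).
Proof.
move=> b0; rewrite dirichlet_densityE /tilt big_split/= !big_ord_recl b0.
have bE j : tnth x (lift ord0 j) `^ (- (a (lift ord0 j) - b (lift ord0 j))) *
    pospow (a (lift ord0 j)) (tnth x (lift ord0 j)) =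
    pospow (b (lift ord0 j)) (tnth x (lift ord0 j)).
  rewrite /pospow; case: ifPn => x0; last by rewrite mulr0.
  rewrite -powRD; last by rewrite (gt_eqF x0) implybT.
  by congr (_ `^ _); ring.
rewrite -(eq_bigr _ (fun j _ => bE j)) big_split/=; ring.
Qed.

End likelihood_ratio.

(** * Expectation of the likelihood ratio and the final bound *)

Section chernoff.
Context {R : realType} {d} {Omega : measurableType d} {P : probability Omega R}.

Lemma dirichlet_tilt_expectation k (a b z : 'I_k.+1 -> R)
    (Y : Omega -> k.+1.-tuple R) :
  (forall i, 0 < a i) -> (forall i, 0 < b i) -> b ord0 = a ord0 ->
  measurable_fun setT Y -> has_dirichlet_law P a Y ->
  (\int[P]_w (tilt z (fun i => a i - b i) (Y w))%:E)%E =
  (mBeta b / mBeta a *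
    \prod_(j < k) z (lift ord0 j) `^ (a (lift ord0 j) - b (lift ord0 j)))%:E.
Proof.
move=> a0 b0 ab mY YP.
rewrite (dirichlet_expectation a0 mY YP)//; last 2 first.
- exact: measurable_tilt.
- by move=> x; exact: tilt_ge0.
under [X in lebInt X]eq_fun do rewrite tilt_density// EFinM.
rewrite (ifunZ (integral_functional_lebInt k)); last 2 first.
- rewrite divr_ge0 ?(ltW (mBeta_gt0 a0))//.
  by rewrite prodr_ge0// => j _; exact: powR_ge0.
- under eq_fun do rewrite prod_pospow_simplex_pt.
  exact: nnmeas_dirichlet_kernel.
by rewrite lebInt_prod_pospow// -EFinM; congr (_%:E); ring.
Qed.

(** The density vanishes off the positive tuples, so this event and the sure event have the same
    integral, and the latter has probability 1. *)
Lemma dirichlet_law_pos k (a : 'I_k.+1 -> R) (Y : Omega -> k.+1.-tuple R) :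
  has_dirichlet_law P a Y ->
  P (Y @^-1` [set x | forall i, 0 < tnth x i]) = 1%E.
Proof.
move=> YP.
move: (@measurable_pos_tuple R k.+1) => mpos.
rewrite YP// -(probability_setT P) -[X in P X](preimage_setT Y) YP//.
congr lebInt; apply/funext => y; congr (_%:E).
rewrite /dirichlet_density; case: ifPn => [/forallP y0|]; last by rewrite !mulr0.
by rewrite !indicE !mem_set.
Qed.

End chernoff.
Unset Implicit Arguments.

Theorem theorem12 (R : realType) (d : measure_display) (Omega : measurableType d)
    (P : probability Omega R) (k n : nat) (alpha z : 'I_k.+1 -> R)
    (X : 'I_n -> Omega -> k.+1.-tuple R) :
  (0 < n)%N ->
  (forall i, 0 < alpha i) ->
  (forall l, measurable_fun [set: Omega] (X l)) ->
  (forall l, has_dirichlet_law P alpha (X l)) ->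
  mutually_independent P X ->
  (forall i, 0 < z i) ->
  \sum_(i < k.+1) z i = 1 ->
  let mu := fun i => alpha i / \sum_(l < k.+1) alpha l in
  let alphahat := fun i => alpha ord0 * z i / z ord0 in
  let Xbar := fun w (i : 'I_k.+1) => n%:R^-1 * \sum_(l < n) tnth (X l w) i in
  prec z mu ->
  (P [set w | prec (Xbar w) z] <=
   (((mBeta alphahat / mBeta alpha) *
     \prod_(i < k.+1 | (0 < i)%N) (z i `^ (alpha i) / z i `^ (alphahat i)))
      ^+ n)%:E)%E.
Proof.
move=> n0 alpha0 mX XP indX z0 sumz mu alphahat Xbar zmu.
have A0 : 0 < \sum_(l < k.+1) alpha l.
  by rewrite big_ord_recl ltr_pwDl// sumr_ge0// => i _; exact: ltW.
have hat0 i : 0 < alphahat i by rewrite divr_gt0// mulr_gt0.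
have hatE : alphahat ord0 = alpha ord0.
  by rewrite /alphahat mulfK// gt_eqF.
(* Both [z] and [mu] sum to 1, so [z_i <= mu_i] for all [i >= 1] forces [mu_0 <= z_0]. *)
have mu0 : alpha ord0 / z ord0 <= \sum_(l < k.+1) alpha l.
  rewrite ler_pdivrMr// mulrC -ler_pdivrMr//.
  have summu : \sum_i mu i = 1 by rewrite -mulr_suml divff// gt_eqF.
  have : \sum_(i < k) z (lift ord0 i) <= \sum_(i < k) mu (lift ord0 i).
    by apply: ler_sum => i _; exact: zmu.
  rewrite -/(mu ord0).
  by move: sumz summu; rewrite big_ord_recl (big_ord_recl k mu); lra.
(* With [A] the sum of the [alpha_i], [alphahat_j = (alpha_0 / z_0) z_j <= A z_j <= A mu_j =
   alpha_j]; this makes the tilting exponents nonnegative. *)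
have hat_le j : alphahat (lift ord0 j) <= alpha (lift ord0 j).
  rewrite /alphahat mulrAC.
  apply: le_trans (ler_wpM2r (ltW (z0 _)) mu0) _.
  by rewrite mulrC -ler_pdivlMr//; exact: zmu.
pose t i := alpha i - alphahat i.
set E := [set w | prec (Xbar w) z].
have mXi l i : measurable_fun setT (fun w => tnth (X l w) i).
  exact: ((measurable_fun_tnthP _).1 (mX l) i).
have mE : measurable E.
  have -> : E = \bigcap_(i in [set i : 'I_k.+1 | (0 < i)%N])
      ((fun w => Xbar w i) @^-1` `]-oo, z i]).
    apply/seteqP; split => w /= wz i i0; first by rewrite /= in_itv/= wz.
    by have := wz i i0; rewrite /= in_itv.
  apply: fin_bigcap_measurable => // i _.
  rewrite -[X in measurable X]setTI.
  have : measurable_fun setT (fun w => Xbar w i).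
    by apply: measurable_funM => //; exact: measurable_sum.
  by apply => //; exact: measurable_itv.
have mprod : measurable_fun setT (fun w => \prod_l tilt z t (X l w)).
  apply: measurable_prod => l _.
  exact: (measurableT_comp (measurable_tilt z t) (mX l)).
have tilt_mean l : (\int[P]_w (tilt z t (X l w))%:E)%E = _ :=
  dirichlet_tilt_expectation z alpha0 hat0 hatE (mX l) (XP l).
have EX := independent_expectation_prod mX indX
  (fun _ => measurable_tilt z t) (fun _ => tilt_ge0 z t) tilt_mean.
rewrite prod_ord_gt0.
under eq_bigr do rewrite -powRB ?(gt_eqF (z0 _)) ?implybT//.
(* The right-hand side becomes the expectation of the product of tilts, and the probability an
   integral of the indicator of [E]; it remains to compare integrands. *)
move: EX; rewrite prodr_const card_ord => <-.
rewrite -[X in P X]setIT -integral_indic//.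
(* AM-GM needs positive coordinates, which the samples have only almost surely, so the integrands
   are compared off a null set. *)
pose pos := [set x : k.+1.-tuple R | forall i, 0 < tnth x i].
have mpos : measurable pos by exact: measurable_pos_tuple.
have mXpos l : measurable (X l @^-1` pos).
  by rewrite -[X in measurable X]setTI; exact: mX.
have mcap : measurable (\bigcap_(l in [set: 'I_n]) (X l @^-1` pos)).
  by apply: fin_bigcap_measurable.
have Ppos : P (\bigcap_(l in [set: 'I_n]) (X l @^-1` pos)) = 1%E.
  rewrite (indX (fun=> pos))//; apply: big1 => l _.
  exact: dirichlet_law_pos (XP l).
have PN : P (~` (\bigcap_(l in [set: 'I_n]) (X l @^-1` pos))) = 0%E.
  by rewrite (probability_setC P mcap) Ppos subee.
apply: ae_ge0_le_integral => //.
- by apply/measurable_EFinP; exact: measurable_indic.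
- by move=> w _; rewrite lee_fin prodr_ge0// => l _; exact: tilt_ge0.
- exact/measurable_EFinP.
exists (~` (\bigcap_(l in [set: 'I_n]) (X l @^-1` pos))); split.
- exact: measurableC.
- exact: PN.
apply: subsetC => w wpos _; rewrite lee_fin indicE.
have [/set_mem wE|_] := boolP (_ \in _); last first.
  by rewrite prodr_ge0// => l _; exact: tilt_ge0.
(* Swapping the products isolates each coordinate [j], where AM-GM runs over the samples. *)
rewrite /tilt exchange_big/=.
apply: (big_ind (fun a => 1 <= a)) => // [a b|j _]; first exact: mulr_ege1.
apply: le_mean_prod_div => //.
- by rewrite subr_ge0.
- by move=> l; exact: wpos.
- exact: wE.
Qed.
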